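(* For the frog model on $\mathbb{Z}$ with drift parameter $p$, where $\frac12\le p<1$, the speed of the maximum satisfies $v_{\max}<1$.
   Context: Frog model on $\mathbb{Z}$ with drift parameter $p\in[\frac12,1]$: $\mathbb{N}=\{1,2,\dots\}$, $\mathbb{N}_0=\mathbb{N}\cup\{0\}$. Let $(X_k^i)_{i\in\mathbb{Z},k\in\mathbb{N}}$ be i.i.d. with $\mathbb{P}(X_1^0=1)=p=1-\mathbb{P}(X_1^0=-1)$, and $S_n^i=\sum_{k=1}^n X_k^i$ for $i\in\mathbb{Z}$, $n\in\mathbb{N}_0$. Initially there is one active frog at $0$ and one sleeping frog at every other site of $\mathbb{Z}$. An active frog moves at each discrete time step according to its own random walk; a sleeping frog does not move, and it becomes active the first time an active frog visits its site, after which it starts its own walk and can wake up other frogs. The frog initially at $i$ is activated at time $T_i\in\mathbb{N}_0\cup\{\infty\}$; formally, with $t(x,y)=\inf\{n\in\mathbb{N}_0: x+S_n^x=y\}$ ($\inf\emptyset=\infty$), $T_i=\inf \sum_{l=1}^{k} t(x_{l-1},x_l)$, the infimum being over all $k\in\mathbb{N}$ and finite sequences $x_0,\dots,x_k\in\mathbb{Z}$ with $x_0=0$, $x_k=i$; in particular $T_0=0$. Its location at time $n$ is $Z_n^i=i$ if $n<T_i$ and $Z_n^i=i+S^i_{n-T_i}$ if $n\ge T_i$. The set of active frogs at time $n$ is $A_n=\{i\in\mathbb{Z}:T_i\le n\}$, and $M_n=\max_{i\in A_n}Z_n^i$. It is known that for each $p$ there is a positive constant $v_{\max}=v_{\max}(p)$,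 called the speed of the maximum, with $v_{\max}=\lim_{n\to\infty}\frac{M_n}{n}$ almost surely. *)

(* Defs.v *)
From HB Require Import structures.
From mathcomp Require Import all_boot all_order all_algebra.
From mathcomp Require Import all_classical all_reals all_analysis.
Set Implicit Arguments.
Unset Strict Implicit.
Unset Printing Implicit Defensive.
Import Order.TTheory GRing.Theory Num.Theory.
Import numFieldNormedType.Exports.
Local Open Scope classical_set_scope.
Local Open Scope ring_scope.

HB.instance Definition _ := isPointed.Build int 0.
HB.instance Definition _ := @isMeasurable.Build default_measure_display
  int discrete_measurable discrete_measurable0
  discrete_measurableC discrete_measurableU.

Section frog_path.
Variables (R : realType) (x : int -> nat -> int).

(* One realization of the model: since indices start at 0, [x i k] is the
   (k+1)-st step of frog i. *)

Definition walk (i : int) (n : nat) : int := \sum_(k < n) x i k.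

(* N_0 with infinity is represented inside [\bar R]; [ereal_inf set0 = +oo]. *)
Definition hitting_time (y z : int) : \bar R :=
  ereal_inf [set (n%:R)%:E | n in [set n : nat | y + walk y n = z]].

Definition activation_time (i : int) : \bar R :=
  ereal_inf [set u | exists (k : nat) (s : nat -> int),
    [/\ (0 < k)%N, s 0%N = 0, s k = i &
        u = (\sum_(l < k) hitting_time (s l) (s l.+1))%E]].

(* [activation_time i] is either +oo or a natural number, and in the second
   branch it is at most n, so [truncn (fine _)] loses nothing. *)
Definition location (i : int) (n : nat) : int :=
  if ((n%:R)%:E < activation_time i)%E then i
  else i + walk i (n - Num.truncn (fine (activation_time i))).

Definition active (n : nat) : set int :=
  [set i | (activation_time i <= (n%:R)%:E)%E].

(* The greatest element of {location i n | i active at time n}. When all steps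
   are +1 or -1 this set is finite and nonempty, so the default value 0 is
   never used. *)
Definition frog_max (n : nat) : int :=
  xget 0 [set m | [set location i n | i in active n] m /\
                  forall i, active n i -> location i n <= m].

End frog_path.

Section frog_model.
Context (d : measure_display) (T : measurableType d) (R : realType)
  (P : probability T R).

Definition mutually_independent (I : eqType) d' (E : measurableType d')
    (X : I -> {RV P >-> E}) : Prop :=
  forall (J : seq I) (B : I -> set E), uniq J ->
    (forall j, measurable (B j)) ->
    P [set w | forall j, j \in J -> B j (X j w)] =
    (\prod_(j <- J) P (X j @^-1` B j))%E.

Definition identically_distributed (I : Type) d' (E : measurableType d')
    (X : I -> {RV P >-> E}) : Prop :=
  forall (i j : I) (B : set E), measurable B ->
    P (X i @^-1` B) = P (X j @^-1` B).

Definition frog_steps (p : R) (X : int -> nat -> {RV P >-> int}) : Prop :=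
  [/\ mutually_independent (fun ik : int * nat => X ik.1 ik.2),
      identically_distributed (fun ik : int * nat => X ik.1 ik.2),
      P (X 0 0%N @^-1` [set 1]) = p%:E &
      P (X 0 0%N @^-1` [set -1]) = (1 - p)%:E].

Definition speed_of_maximum (X : int -> nat -> {RV P >-> int}) (v : R) : Prop :=
  {ae P, forall w,
    (fun n : nat => (frog_max R (fun i k => X i k w) n)%:~R / n%:R : R)
      @ \oo --> v}.

End frog_model.

(* Main.v *)
Require Import Defs.
From mathcomp Require Import all_boot all_order all_algebra.
From mathcomp Require Import all_classical all_reals all_analysis.
From mathcomp Require Import measurable_realfun.
From mathcomp Require Import zify ring lra.

(** If the maximum had speed at least 1, site M would be activated at a time
    T_M = M + o(M), and the front would run to the right almost without delay.
    But a frog that starts K sites to the left of N keeps up with such a front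
    only if it makes hardly any left step, and with positive probability no
    frog to the left of N does so. The two facts are incompatible, and they are
    compared by counting sites.

    Fix an integer r and say that the frog at N - K lags if at least K / r of
    its first K steps go to the left. Some frog i < N realizes the activation
    of N, after T_N - T_i steps or fewer. If it lags, these steps contain
    K / r left ones, where K = N - i, so the delay T_N - T_i - K between i and
    N is at least 2 K / r. Hence, at a site N behind which all frogs lag, the
    delay T_j - j grows by 2 (N - i) / r over some interval from i to N. Since
    the delay is nondecreasing, such intervals cover at most r (T_M - M) / 2
    of the sites up to M ([count_steep], [count_all_lag]). So if the speed is
    at least 1, then almost surely a vanishing fraction of the sites N <= M
    has only lagging frogs behind it ([all_lag_frequency_cvg0]).

    On the other hand, for suitable r, the probability that all frogs behind N
    lag is bounded below uniformly in N ([prob_all_lag_ge]). The K0 nearest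
    frogs make K0 left steps each with probability (1 - p) ^ (K0 * K0), and
    independently of this the frog at distance K fails to lag with probability
    at most q ^ K for some q < 1 (a Chernoff bound, [prob_few_lefts]), which
    is summable, with a sum over K > K0 of at most 1/2 for large K0. The
    expected fraction of such sites is therefore bounded below, and by
    dominated convergence it cannot vanish almost surely
    ([prob_le0_of_frequency]).

    The events that all frogs behind N lag do not refer to activation times,
    so that no conditioning on the past of the front is involved. *)

Set Implicit Arguments.
Unset Strict Implicit.
Unset Printing Implicit Defensive.
Import Order.TTheory GRing.Theory Num.Theory.
Import numFieldNormedType.Exports.
Local Open Scope classical_set_scope.
Local Open Scope ring_scope.

(** * Activation paths *)

Definition pm1_steps (x : int -> nat -> int) : Prop :=
  forall i k, x i k = 1 \/ x i k = -1.

Definition lefts (x : int -> nat -> int) (i : int) (n : nat) : nat :=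
  (\sum_(k < n) (x i k == -1)%R)%N.

(** A chain of frogs may bring activity to a site at several times, not only
    at the first one; working with all of them avoids infima, and the
    activation time is recovered as the least of them. *)
Inductive reached (x : int -> nat -> int) : int -> nat -> Prop :=
| reached_origin : reached x 0 0
| reached_walk y z c n :
    reached x y c -> y + walk x y n = z -> reached x z (c + n)%N.

Lemma walk0 x i : walk x i 0 = 0.
Proof. by rewrite /walk big_ord0. Qed.

Lemma walkS x i n : walk x i n.+1 = walk x i n + x i n.
Proof. by rewrite /walk big_ord_recr. Qed.

Lemma leftsS x i n : lefts x i n.+1 = (lefts x i n + (x i n == -1)%R)%N.
Proof. by rewrite /lefts big_ord_recr. Qed.

Lemma leq_lefts x i m n : (m <= n)%N -> (lefts x i m <= lefts x i n)%N.
Proof.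
move=> /subnKC <-; elim: (n - m)%N => [|k IH]; first by rewrite addn0.
by rewrite addnS leftsS (leq_trans IH) // leq_addr.
Qed.

Lemma walk_lefts x i n : pm1_steps x -> walk x i n = n%:Z - (2 * lefts x i n)%:Z.
Proof.
move=> hx; elim: n => [|n IH]; first by rewrite walk0 /lefts big_ord0.
by rewrite walkS leftsS IH; case: (hx i n) => ->; rewrite ?eqxx /=; lia.
Qed.

(** A discrete intermediate value theorem, with the extra information that
    the walk needs at least one step per site from the crossing of z on. *)
Lemma walk_crosses x y n z : pm1_steps x -> y < z -> z <= y + walk x y n ->
  exists2 u, y + walk x y u = z & (y + walk x y n - z) + u%:Z <= n%:Z.
Proof.
move=> hx yz; elim: n => [|n IH]; first by rewrite walk0; lia.
have [zn _|nz zS] := lerP z (y + walk x y n).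
  have [u uz le_u] := IH zn; exists u => //; rewrite walkS.
  by case: (hx y n) => ->; lia.
by exists n.+1; move: zS; rewrite walkS; case: (hx y n) => ->; lia.
Qed.

(** The chain starts at 0, so one of its frogs goes from a site below z to z
    or beyond; it must cross z, after which the distance y - z takes at least
    as many time steps. *)
Lemma reached_from_left x y c z : pm1_steps x -> reached x y c ->
  0 < z -> z <= y ->
  exists i c0 s, [/\ i < z, reached x i c0, i + walk x i s = z &
    (c0 + s)%N%:Z + (y - z) <= c%:Z].
Proof.
move=> hx; elim=> [|{}y y' {}c n yc IH yn z0 zy']; first by lia.
have [zy|yz] := lerP z y.
  have [i [c0 [s [iz ic0 isz le]]]] := IH z0 zy.
  by exists i, c0, s; split=> //; have := walk_lefts y n hx; lia.
move: zy'; rewrite -yn => zy'; have [u uz le] := walk_crosses hx yz zy'.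
by exists y, c, u; split=> //; lia.
Qed.

Lemma reached_before x y c z : pm1_steps x -> reached x y c ->
  0 <= z -> z <= y -> exists2 c', reached x z c' & c'%:Z + (y - z) <= c%:Z.
Proof.
move=> hx yc; rewrite le_eqVlt => /orP[/eqP <- y0|z0 zy].
  exists 0%N; first exact: reached_origin.
  elim: yc y0 => [//|{}y y' {}c n _ IH yn _].
  by have := walk_lefts y n hx; case: (lerP 0 y) => [/IH|]; lia.
have [i [c0 [s [_ ic0 isz le]]]] := reached_from_left hx yc z0 zy.
by exists (c0 + s)%N => //; exact: reached_walk ic0 isz.
Qed.

(** * The delay of the front and the frogs that lag *)

(** For f the activation times of the sites 0, 1, ..., this says that over
    some interval (i, N] the delay f j - j grows at a rate of at least 2 / r
    per site. *)
Definition steep (r : nat) (f : nat -> nat) (N : nat) : bool :=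
  [exists i : 'I_N, 2 * (N - i) <= r * (f N - f i - (N - i))]%N.

Lemma leq_in_count (T : eqType) (a1 a2 : pred T) (s : seq T) :
  (forall y, y \in s -> a1 y -> a2 y) -> (count a1 s <= count a2 s)%N.
Proof.
elim: s => //= y s IH sub; apply: leq_add.
  by case: (a1 y) (sub y (mem_head y s)) => //= ->.
by apply: IH => z zs; apply: sub; rewrite inE zs orbT.
Qed.

Lemma incr_gap (f : nat -> nat) M : (forall i, i < M -> f i < f i.+1)%N ->
  forall i j, (i <= j)%N -> (j <= M)%N -> (f i + (j - i) <= f j)%N.
Proof.
move=> f_incr i j /subnKC <-; elim: (j - i)%N => [|k IH] le.
  by rewrite addn0; lia.
by have := f_incr (i + k)%N; rewrite addnS in le *; lia.
Qed.

(** The sites where f is steep are covered by disjoint intervals (i, N] on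
    which the delay f j - j increases by at least 2 (N - i) / r. The intervals
    are found by going down from M: below a steep site N, continue from its
    witness i. *)
Lemma count_steep r f M : (forall i, i < M -> f i < f i.+1)%N ->
  (2 * count (steep r f) (iota 1 M) <= r * (f M - f 0 - M))%N.
Proof.
move=> f_incr.
have f_gap := incr_gap f_incr.
suff: forall n, (n <= M)%N ->
    (2 * count (steep r f) (iota 1 n) <= r * (f n - f 0 - n))%N by exact.
elim/ltn_ind => -[|n] IH nM //.
have [/existsP[[i iN] st]|fl] := boolP (steep r f n.+1).
- rewrite /= in st.
  have iotaE : iota 1 n.+1 = iota 1 (i + (n.+1 - i)) by congr iota; lia.
  rewrite iotaE iotaD count_cat mulnDr.
  have := IH i iN (leq_trans (ltnW iN) nM).
  have := count_size (steep r f) (iota (1 + i) (n.+1 - i)); rewrite size_iota.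
  have -> : (f n.+1 - f 0 - n.+1 = (f n.+1 - f i - (n.+1 - i)) + (f i - f 0 - i))%N.
    have := f_gap 0%N i; have := f_gap i n.+1; lia.
  rewrite mulnDr; lia.
- have -> : iota 1 n.+1 = iota 1 n ++ [:: n.+1] by rewrite -(iotaD 1 n 1) addn1.
  rewrite count_cat /= (negbTE fl) !addn0.
  apply: leq_trans (IH n _ _) _ => //; first by lia.
  rewrite leq_mul2l; have := f_gap n n.+1; lia.
Qed.

(** The bound L on the distance only serves to make the event depend on
    finitely many steps; it is chosen above the time that matters. *)
Definition all_lag (r L : nat) (x : int -> nat -> int) (N : nat) : bool :=
  [forall K : 'I_L.+1, (K <= r * lefts x (N%:Z - K%:Z) K)%N].

(** Along the activation times, every site behind which all frogs lag is
    steep: the frog i that activates N needs s steps with s - (N - i) twice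
    its number of left steps, and these are at least (N - i) / r as it lags. *)
Lemma count_all_lag x r c L M : pm1_steps x -> reached x M%:Z c -> (c <= L)%N ->
  (2 * count (all_lag r L x) (iota 1 M) <= r * (c - M))%N.
Proof.
move=> hx hc cL.
have ex_f (j : nat) : exists t : nat, (j <= M)%N ->
    reached x j%:Z t /\ forall u, reached x j%:Z u -> (t <= u)%N.
  have [jM|] := boolP (j <= M)%N; last by exists 0%N.
  have [u hu _] := reached_before hx hc (isT : 0 <= j%:Z) jM.
  have exu : exists u, `[< reached x j%:Z u >] by exists u; exact/asboolP.
  case: (ex_minnP exu) => t /asboolP ht tmin; exists t => _; split=> // v hv.
  by apply: tmin; exact/asboolP.
(* From here on, f j is the activation time of site j. *)
have [f fP] := choice ex_f.
have f0 : f 0%N = 0%N.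
  have [_ /(_ 0%N (reached_origin x))] := fP 0%N isT; lia.
have f_incr i : (i < M)%N -> (f i < f i.+1)%N.
  move=> iM; have [r1 _] := fP i.+1 iM; have [_ m0] := fP i (ltnW iM).
  have [|u /m0] := reached_before hx r1 (isT : 0 <= i%:Z); lia.
have fM : (f M <= c)%N by have [_ ->] := fP M (leqnn M).
have f_le N : (N <= M)%N -> (f N <= c)%N.
  by move=> NM; have := incr_gap f_incr NM (leqnn M); lia.
apply: leq_trans (leq_trans (count_steep r f_incr) _); last first.
  by rewrite f0 leq_mul2l; lia.
rewrite leq_mul2l /=; apply: leq_in_count => N; rewrite mem_iota => /andP[N0 NM].
move=> /forallP hN; apply/existsP; have {}NM : (N <= M)%N by lia.
have [rN _] := fP N NM.
have [i [c0 [s [iN ic0 isN le]]]] := reached_from_left hx rN (N0 : 0 < N%:Z) (lexx _).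
have ws := walk_lefts i s hx.
pose K := `|N%:Z - i|%N.
have Ks : (K <= s)%N by lia.
have KL : (K < L.+1)%N by have := f_le N NM; lia.
have := hN (Ordinal KL); rewrite /= (_ : N%:Z - K%:Z = i); last by lia.
move=> hK; have lK := leq_lefts x i Ks.
have {}hK : (2 * K <= r * (f N - c0 - K))%N.
  have : (2 * K <= r * (2 * lefts x i K))%N by lia.
  by move/leq_trans; apply; rewrite leq_mul2l; lia.
case: i @K Ks KL hK ic0 iN {isN ws lK le} => i K Ks KL hK ic0 iN.
- have iN' : (i < N)%N by lia.
  exists (Ordinal iN') => /=; have -> : (N - i)%N = K by lia.
  apply: leq_trans hK _; rewrite leq_mul2l.
  have [_ /(_ _ ic0)] := fP i (leq_trans (ltnW iN') NM); lia.
(* A frog from the negative side is no closer to N than 0 is, and its own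
   activation is no earlier than that of 0, at time 0. So the interval from 0
   shows at least the same delay over a distance that is no larger. *)
- exists (Ordinal N0) => /=; rewrite subn0 f0 subn0.
  have NK : (N <= K)%N by lia.
  apply: leq_trans (leq_trans hK _); first by lia.
  by rewrite leq_mul2l; lia.
Qed.

(** * From the ranges of the model to activation paths *)

(** The values +oo and n%:R form a well-ordered set. *)
Lemma ereal_inf_nat_attained (R : realType) (A : set (\bar R)) :
  (forall u, A u -> u = +oo%E \/ exists n : nat, u = (n%:R)%:E) ->
  ereal_inf A = +oo%E \/ A (ereal_inf A).
Proof.
move=> A_nat; have [[n An]|noA] := pselect (exists n : nat, A (n%:R)%:E).
- right; have exA : exists n : nat, `[< A (n%:R)%:E >] by exists n; exact/asboolP.
  case: (ex_minnP exA) => m /asboolP Am m_min.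
  suff -> : ereal_inf A = (m%:R)%:E by [].
  apply/eqP; rewrite eq_le ereal_inf_lbound//=; apply: le_ereal_inf_tmp => u Au.
  have [->|[k uk]] := A_nat u Au; first by rewrite leey.
  by rewrite uk lee_fin ler_nat m_min//; apply/asboolP; rewrite -uk.
- left; apply/eqP; rewrite -leye_eq; apply: le_ereal_inf_tmp => u Au.
  have [-> //|[k uk]] := A_nat u Au; by case: noA; exists k; rewrite -uk.
Qed.

Section bridge.
Variables (R : realType) (x : int -> nat -> int).

Lemma hitting_timeP y z : hitting_time R x y z = +oo%E \/
  exists2 n : nat, y + walk x y n = z & hitting_time R x y z = (n%:R)%:E.
Proof.
rewrite /hitting_time; have [|->|[n /= nz <-]] := @ereal_inf_nat_attained R
    [set (n%:R)%:E | n in [set n : nat | y + walk x y n = z]]%classic.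
- by move=> _ [n _ <-]; right; exists n.
- by left.
- by right; exists n.
Qed.

Lemma chain_reached (s : nat -> int) k : s 0%N = 0 ->
  (\sum_(l < k) hitting_time R x (s l) (s l.+1))%E = +oo%E \/
  exists2 c : nat, reached x (s k) c &
    (\sum_(l < k) hitting_time R x (s l) (s l.+1))%E = (c%:R)%:E.
Proof.
move=> s0; elim: k => [|k IH].
  by right; exists 0%N; rewrite ?big_ord0// s0; exact: reached_origin.
rewrite big_ord_recr /=.
have [->|[n nz ->]] := hitting_timeP (s k) (s k.+1).
  by left; case: IH => [->|[c _ ->]].
case: IH => [->|[c rc ->]]; first by left.
by right; exists (c + n)%N; [exact: reached_walk rc nz | rewrite natrD EFinD].
Qed.

Lemma active_reached i n : active R x n i -> exists c : nat,
  [/\ reached x i c, (c <= n)%N & activation_time R x i = (c%:R)%:E].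
Proof.
rewrite /active /= => Tn.
have [|Too|] := @ereal_inf_nat_attained R [set u | exists (k : nat) (s : nat -> int),
    [/\ (0 < k)%N, s 0%N = 0, s k = i &
        u = (\sum_(l < k) hitting_time R x (s l) (s l.+1))%E]]%classic.
- move=> _ [k [s [_ s0 _ ->]]].
  by have [->|[c _ ->]] := chain_reached k s0; [left|right; exists c].
- by move: Tn; rewrite /activation_time Too leye_eq.
- move=> [k [s [_ s0 sk uE]]]; rewrite -/(activation_time R x i) in uE.
  have [E|[c rc E]] := chain_reached k s0; rewrite E in uE.
    by move: Tn; rewrite uE leye_eq.
  by exists c; split=> //; [rewrite -sk|move: Tn; rewrite uE lee_fin ler_nat].
Qed.

(** The frog at the maximum either was activated at j or beyond, or has
    crossed j since its activation. *)
Lemma reached_below_frog_max (n j : nat) : pm1_steps x ->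
  j%:Z <= frog_max R x n -> exists2 c, reached x j%:Z c & (c <= n)%N.
Proof.
move=> hx; rewrite /frog_max; case: xgetP => [m -> [[i /active_reached]]|_]; last first.
  by case: j => // _; exists 0%N => //; exact: reached_origin.
move=> [c [ic cn iE]]; rewrite /location iE lte_fin ltr_nat ltnNge cn /= natrK => <- _ jm.
have [ji|ij] := lerP j%:Z i.
  by have [c' jc' le] := reached_before hx ic (isT : 0 <= j%:Z) ji; exists c' => //; lia.
have [u uj le] := walk_crosses hx ij jm.
by exists (c + u)%N; [exact: reached_walk ic uj | lia].
Qed.

End bridge.

(** * Sums and measures *)

Lemma measure_le_sum_cover (d : measure_display) (T : measurableType d)
    (R : realType) (mu : {measure set T -> \bar R}) (I : eqType) (s : seq I)
    (F : I -> set T) (E : set T) :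
  measurable E -> (forall a, measurable (F a)) ->
  (forall w, E w -> exists2 a, a \in s & F a w) ->
  (mu E <= \sum_(a <- s) mu (F a))%E.
Proof.
move=> mE mF; elim: s E mE => [|a s IH] E mE cov.
  rewrite big_nil (_ : E = set0) ?measure0//.
  by rewrite predeqE => w; split=> // /cov[].
have mI : measurable (E `&` F a) by exact: measurableI.
have mD : measurable (E `\` F a) by exact: measurableD.
rewrite big_cons -[in leLHS](setUIDK E (F a)).
apply: le_trans (measureU2 mu mI mD) _.
apply: leeD.
  by apply: le_measure; rewrite ?inE//; exact: subIsetr.
apply: IH => // w [/cov[b]].
by rewrite inE => /orP[/eqP ->|bs Fb _] // ; exists b.
Qed.

(** A Chernoff bound, with the sum over A in the place of an expectation: as
    t <= 1, each set with r * #|A| < K may be weighted by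
    t ^+ (r * #|A|) / t ^+ K >= 1, and then the sum over all A factorizes. *)
Lemma sum_few_le (R : realFieldType) (K r : nat) (a b t : R) :
  0 <= a -> 0 <= b -> 0 < t -> t <= 1 ->
  \sum_(A : {set 'I_K} | (r * #|A| < K)%N) \prod_(k < K) (if k \in A then a else b)
    <= ((a * t ^+ r + b) / t) ^+ K.
Proof.
move=> a0 b0 t0 t1.
have prod_t (A : {set 'I_K}) : \prod_(k < K) (if k \in A then a * t ^+ r else b) =
    \prod_(k < K) (if k \in A then a else b) * t ^+ (r * #|A|).
  rewrite exprM -prodr_const [X in _ = _ * X]big_mkcond -big_split /=.
  by apply: eq_bigr => k _; case: ifP; rewrite ?mulr1.
rewrite expr_div_n ler_pdivlMr ?exprn_gt0//.
have -> : (a * t ^+ r + b) ^+ K = \prod_(k < K) (a * t ^+ r + b).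
  by rewrite prodr_const card_ord.
rewrite bigA_distr mulr_suml big_mkcond /=; apply: ler_sum => A _.
have pr0 : 0 <= \prod_(k < K) (if k \in A then a else b).
  by apply: prodr_ge0 => k _; case: ifP.
rewrite prod_t; case: ifP => [rA|_]; last by rewrite mulr_ge0// exprn_ge0// ltW.
by apply: ler_wpM2l => //; apply: ler_wiXn2l => //; [exact: ltW|exact: ltnW].
Qed.

Lemma expr_small (R : realType) (t e : R) : 0 <= t -> t < 1 -> 0 < e ->
  exists n, t ^+ n.+1 < e.
Proof.
move=> t0 t1 e0; have t_cvg : t ^+ n @[n --> \oo] --> (0 : R).
  by apply: cvg_expr; rewrite ger0_norm.
have [n _ nP] := @cvgr_lt _ _ _ _ _ _ t_cvg _ e0.
by exists n; apply: nP => /=.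
Qed.

Lemma geometric_tail_le (R : realFieldType) (t : R) (m n : nat) :
  0 <= t -> t < 1 -> \sum_(k <- iota m n) t ^+ k <= t ^+ m / (1 - t).
Proof.
move=> t0 t1; have t1' : 0 < 1 - t by rewrite subr_gt0.
rewrite ler_pdivlMr//.
suff -> : (\sum_(k <- iota m n) t ^+ k) * (1 - t) = t ^+ m - t ^+ (m + n).
  by rewrite gerBl exprn_ge0.
elim: n m => [|n IH] m; first by rewrite big_nil addn0 mul0r subrr.
by rewrite /= big_cons mulrDl IH addSnnS exprS; ring.
Qed.

(** * The steps of the frogs as independent signs *)

Section steps.
Context (d : measure_display) (T : measurableType d) (R : realType)
  (P : probability T R) (p : R) (X : int -> nat -> {RV P >-> int}).
Hypothesis hX : frog_steps p X.

Definition realization (w : T) : int -> nat -> int := fun i k => X i k w.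

Lemma measurable_step i k (B : set int) : measurable (X i k @^-1` B).
Proof. by rewrite -[X in measurable X]setTI; exact: measurable_funPT. Qed.

Lemma prob_left i k : P (X i k @^-1` [set -1]) = (1 - p)%:E.
Proof.
by case: hX => _ ident _ <-; exact: (ident (i, k) (0, 0%N)).
Qed.

Lemma prob_right i k : P (X i k @^-1` [set 1]) = p%:E.
Proof.
by case: hX => _ ident <- _; exact: (ident (i, k) (0, 0%N)).
Qed.

Lemma ae_pm1_steps : {ae P, forall w, pm1_steps (realization w)}.
Proof.
have step i k : {ae P, forall w, realization w i k = 1 \/ realization w i k = -1}.
  exists (X i k @^-1` ~` ([set 1] `|` [set -1])); split.
  - exact: measurable_step.
  - rewrite -preimage_setC probability_setC; last exact: measurable_step.
    have disj : X i k @^-1` [set 1] `&` X i k @^-1` [set -1] = set0.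
      by apply/seteqP; split=> // w [/= ->].
    rewrite preimage_setU measureU; try exact: measurable_step; last by [].
    transitivity (1 - (p%:E + (1 - p)%:E))%E.
      by congr (1 - (_ + _))%E; [exact: prob_right|exact: prob_left].
    rewrite -EFinD (_ : p + (1 - p) = 1); last by ring.
    by rewrite subrr.
  - by move=> w nw h; apply: nw; exact: h.
have frog i : {ae P, forall w, forall k,
    realization w i k = 1 \/ realization w i k = -1}.
  by apply: ae_foralln => k; exact: step.
have pos : {ae P, forall w, forall n k : nat,
    realization w n%:Z k = 1 \/ realization w n%:Z k = -1}.
  by apply: ae_foralln => n; exact: frog.
have neg : {ae P, forall w, forall n k : nat,
    realization w (Negz n) k = 1 \/ realization w (Negz n) k = -1}.
  by apply: ae_foralln => n; exact: frog.
by move: pos neg; apply: filterS2 => w hpos hneg [] n k; [exact: hpos|exact: hneg].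
Qed.

Lemma measurable_lefts (Q : nat -> Prop) i n :
  measurable [set w | Q (lefts (realization w) i n)].
Proof.
elim: n Q => [|n IH] Q.
  have [Q0|nQ0] := pselect (Q 0%N).
    rewrite (_ : mkset _ = setT) //; apply/seteqP; split=> // w _ /=.
    by rewrite /lefts big_ord0.
  rewrite (_ : mkset _ = set0) //; apply/seteqP; split=> // w /=.
  by rewrite /lefts big_ord0.
rewrite (_ : mkset _ =
    (X i n @^-1` [set -1] `&` [set w | Q ((lefts (realization w) i n).+1)]) `|`
    ((X i n @^-1` (~` [set -1])) `&` [set w | Q (lefts (realization w) i n)])).
  apply: measurableU; apply: measurableI; try exact: measurable_step.
    exact: (IH (fun m => Q m.+1)).
  exact: IH.
apply/seteqP; split=> w; rewrite /= leftsS /realization.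
  by case: eqP => [->|]; rewrite ?addn1 ?addn0; [left|right].
by case=> -[] => [->|/eqP/negbTE ->]; rewrite ?eqxx ?addn1 ?addn0.
Qed.

Lemma measurable_all_lag r L N : measurable [set w | all_lag r L (realization w) N].
Proof.
rewrite (_ : mkset _ = \bigcap_(K : nat)
   [set w | (K <= L)%N -> (K <= r * lefts (realization w) (N%:Z - K%:Z) K)%N]).
  apply: bigcapT_measurable => K.
  exact: measurable_lefts (fun m => _ -> (_ <= r * m)%N) _ _.
apply/seteqP; split=> w /=.
  by move=> /forallP h K _ /= KL; exact: h (Ordinal (KL : (K < L.+1)%N)).
by move=> h; apply/forallP => -[K KL]; exact: h.
Qed.

(** The cylinder on which the step j, for j in J, goes to the left exactly
    when b j holds. *)
Definition left_pattern (J : seq (int * nat)) (b : int * nat -> bool) : set T :=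
  [set w | forall j, j \in J -> (realization w j.1 j.2 == -1) = b j].

Lemma measurable_left_pattern J b : measurable (left_pattern J b).
Proof.
elim: J => [|j J IH].
  by rewrite (_ : left_pattern _ _ = setT)//; apply/seteqP; split.
rewrite (_ : left_pattern _ _ =
    X j.1 j.2 @^-1` [set z | (z == -1) = b j] `&` left_pattern J b).
  by apply: measurableI => //; exact: measurable_step.
apply/seteqP; split=> w.
  by move=> h; split=> [|k kJ]; apply: h; rewrite inE ?eqxx// kJ orbT.
by move=> [hj hJ] k; rewrite inE => /orP[/eqP ->|/hJ].
Qed.

Lemma prob_left_pattern J b : uniq J ->
  P (left_pattern J b) = (\prod_(j <- J) (if b j then 1 - p else p))%:E.
Proof.
move=> uJ; case: hX => indep _ _ _.
rewrite (indep J (fun j => [set z | (z == -1) = b j]) uJ)//.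
rewrite -prodEFin; apply: eq_bigr => j _; case: (b j).
  rewrite -(prob_left j.1 j.2); congr (P _); apply/seteqP.
  by split=> w /= /eqP.
rewrite (_ : _ @^-1` _ = ~` (X j.1 j.2 @^-1` [set -1])).
  rewrite probability_setC ?prob_left; last exact: measurable_step.
  by rewrite -EFinB; congr EFin; ring.
by apply/seteqP; split=> w /=; case: eqP.
Qed.

(** * All frogs lag with positive probability *)

(** Conditionally on a cylinder that does not involve frog i, the number of
    left steps of this frog is still binomial. The event is covered by the
    cylinders that fix in addition the set A of all left steps among the first
    K, so that the product rule for cylinders suffices. *)
Lemma prob_few_lefts J b i K r (t : R) : 0 <= p -> p < 1 ->
  uniq J -> (forall j, j \in J -> j.1 != i) -> 0 < t -> t <= 1 ->
  (P (left_pattern J b `&` [set w | (r * lefts (realization w) i K < K)%N]) <=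
   P (left_pattern J b) * ((((1 - p) * t ^+ r + p) / t) ^+ K)%:E)%E.
Proof.
move=> p0 p1 uJ Ji t0 t1.
pose row := [seq (i, nat_of_ord k) | k <- enum 'I_K].
pose bA (A : {set 'I_K}) (j : int * nat) :=
  if j.1 == i then j.2 \in [seq nat_of_ord k | k <- enum A] else b j.
have bAi A (k : 'I_K) : bA A (i, nat_of_ord k) = (k \in A).
  by rewrite /bA eqxx /= mem_map ?mem_enum//; exact: val_inj.
have bAJ A j : j \in J -> bA A j = b j by rewrite /bA => /Ji/negbTE ->.
have urow : uniq (J ++ row).
  rewrite cat_uniq uJ map_inj_uniq ?enum_uniq => [|k l [] /val_inj//].
  rewrite andbT; apply/hasPn => _ /mapP[k _ ->]; apply/negP => /Ji.
  by rewrite eqxx.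
have few_cover w : (left_pattern J b `&`
      [set w | (r * lefts (realization w) i K < K)%N]) w ->
    exists2 A, A \in [seq A : {set 'I_K} <- enum {set 'I_K} | (r * #|A| < K)%N] &
      left_pattern (J ++ row) (bA A) w.
  move=> [Jw /= few]; pose A := [set k : 'I_K | realization w i k == -1]%SET.
  exists A; first rewrite mem_filter mem_enum andbT.
    suff -> : #|A| = lefts (realization w) i K by [].
    rewrite /lefts -sum1_card big_mkcond; apply: eq_bigr => k _.
    by rewrite inE; case: eqP.
  move=> j; rewrite mem_cat => /orP[jJ|/mapP[k _ ->]]; first by rewrite Jw ?bAJ.
  by rewrite bAi inE.
have mE : measurable (left_pattern J b `&`
    [set w | (r * lefts (realization w) i K < K)%N]).
  apply: measurableI; first exact: measurable_left_pattern.
  exact: measurable_lefts (fun m => r * m < K)%N _ _.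
have mF A := measurable_left_pattern (J ++ row) (bA A).
apply: le_trans (measure_le_sum_cover P mE mF few_cover) _.
rewrite (eq_bigr _ (fun A _ => prob_left_pattern (bA A) urow)).
rewrite prob_left_pattern// sumEFin -EFinM lee_fin big_filter big_enum_cond /=.
under eq_bigr => A _.
  rewrite big_cat big_map big_enum /=.
  under [X in _ * X]eq_bigr do rewrite bAi.
  rewrite (eq_big_seq (fun j => if b j then 1 - p else p)); last first.
    by move=> j jJ; rewrite bAJ.
  over.
rewrite -mulr_sumr; apply: ler_wpM2l; last first.
  by apply: sum_few_le => //; rewrite subr_ge0 ltW.
by apply: prodr_ge0 => j _; case: (b j); rewrite ?subr_ge0 ?(ltW p1).
Qed.

(** Only frogs at distance at most K0 have a substantial chance not to lag,
    and they do lag if their first K0 steps all go to the left. The chance that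
    some other frog does not lag is at most 1/2 by the union bound. *)
Lemma prob_all_lag_ge : 0 <= p -> p < 1 -> exists r : nat, exists2 c : R, 0 < c &
  forall L N, (c%:E <= P [set w | all_lag r L (realization w) N])%E.
Proof.
move=> p0 p1.
(* As r grows, q tends to p / t, which is below 1 as soon as p < t. *)
pose t : R := (1 + p) / 2.
have t0 : 0 < t by rewrite /t; lra.
have t1 : t < 1 by rewrite /t; lra.
have [r tr] : exists n, t ^+ n.+1 < t - p.
  by apply: expr_small => //; [exact: ltW|rewrite /t; lra].
have tr0 : 0 < t ^+ r.+1 by rewrite exprn_gt0.
pose q := ((1 - p) * t ^+ r.+1 + p) / t.
have q0 : 0 <= q by rewrite divr_ge0 ?ltW//; nra.
have q1 : q < 1 by rewrite ltr_pdivrMr//; nra.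
have [K0 qK0] : exists n, q ^+ n.+1 < (1 - q) / 2.
  by apply: expr_small => //; lra.
pose m := (K0 * K0)%N.
exists r.+1, ((1 - p) ^+ m / 2); first by rewrite divr_gt0// exprn_gt0// subr_gt0.
move=> L N.
pose J := [seq (N%:Z - K%:Z, k) | K <- iota 1 K0, k <- iota 0 K0].
have uJ : uniq J.
  apply: allpairs_uniq; rewrite ?iota_uniq// => -[a b] [a' b'] _ _ /= [ab ->].
  by congr pair; lia.
pose C := left_pattern J xpredT.
have PC : P C = ((1 - p) ^+ m)%:E.
  rewrite prob_left_pattern//= big_const_seq count_predT size_allpairs !size_iota.
  by rewrite -/m -Monoid.iteropE.
pose few K := [set w | (r.+1 * lefts (realization w) (N%:Z - K%:Z) K < K)%N].
(* The index None stands for the target event, Some K for a frog at distance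
   K > K0 that does not lag. *)
pose F (o : option nat) := if o is Some K then C `&` few K
                           else [set w | all_lag r.+1 L (realization w) N].
pose far := iota K0.+1 (L - K0).
have mC : measurable C by exact: measurable_left_pattern.
have mF o : measurable (F o).
  case: o => [K|] /=; last exact: measurable_all_lag.
  apply: measurableI => //.
  exact: measurable_lefts (fun m => r.+1 * m < K)%N _ _.
have cover w : C w -> exists2 o, o \in None :: map Some far & F o w.
  move=> Cw; have [hw|nhw] := boolP (all_lag r.+1 L (realization w) N).
    by exists None; rewrite ?mem_head.
  move: nhw; rewrite negb_forall => /existsP[[K KL] /=]; rewrite -ltnNge => fewK.
  have [KK0|K0K] := leqP K K0; last first.
    exists (Some K) => //; rewrite inE /= mem_map; last by move=> ? ? [].
    by rewrite mem_iota; lia.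
  suff lK : lefts (realization w) (N%:Z - K%:Z) K = K.
    by move: fewK; rewrite lK; lia.
  rewrite /lefts (eq_bigr (fun=> 1%N)) => [|k _]; first by rewrite sum1_card card_ord.
  have := Cw (N%:Z - K%:Z, nat_of_ord k); rewrite /= /realization => -> //.
  have kK := ltn_ord k; apply/allpairsP; exists (K, nat_of_ord k).
  by rewrite /= !mem_iota; split=> //; lia.
have := measure_le_sum_cover P mC mF cover.
rewrite big_cons big_map => le_sum.
have far_le : (\sum_(K <- far) P (F (Some K)) <= ((1 - p) ^+ m / 2)%:E)%E.
  apply: (@le_trans _ _ (\sum_(K <- far) ((1 - p) ^+ m * q ^+ K)%:E)%E).
    rewrite !(big_seq_cond xpredT); apply: lee_sum => K; rewrite andbT mem_iota => Kfar.
    rewrite EFinM -PC; apply: prob_few_lefts => //; last exact: ltW.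
    by move=> j /allpairsP[[K' k] [/=]]; rewrite !mem_iota => ? ? -> /=; lia.
  rewrite sumEFin lee_fin -mulr_sumr; apply: ler_wpM2l.
    by rewrite exprn_ge0// subr_ge0 ltW.
  apply: le_trans (geometric_tail_le _ _ q0 q1) _.
  by rewrite ler_pdivrMr ?subr_gt0//; lra.
have fin : P [set w | all_lag r.+1 L (realization w) N] \is a fin_num.
  by apply: fin_num_measure; exact: (mF None).
have : (((1 - p) ^+ m)%:E <=
    P [set w | all_lag r.+1 L (realization w) N] + ((1 - p) ^+ m / 2)%:E)%E.
  by rewrite -PC; apply: le_trans le_sum _; exact: leeD.
by rewrite -(fineK fin) -EFinD !lee_fin; lra.
Qed.

End steps.

(** * Vanishing frequencies *)

(** The mean of the frequency of the events H M N, for 1 <= N <= M, is at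
    least c, and it tends to 0 by dominated convergence. *)
Lemma prob_le0_of_frequency (d : measure_display) (T : measurableType d)
    (R : realType) (P : probability T R) (H : nat -> nat -> T -> bool) (c : R) :
  (forall M N, measurable [set w | H M N w]) ->
  (forall M N, (c%:E <= P [set w | H M N w])%E) ->
  {ae P, forall w, (fun M : nat =>
     (count (fun N => H M N w) (iota 1 M))%:R / M%:R : R) @ \oo --> (0 : R)} ->
  c <= 0.
Proof.
move=> mH cH freq0.
pose freq (M : nat) (w : T) : R := (count (fun N => H M N w) (iota 1 M))%:R / M%:R.
have freqE M w : (freq M w)%:E =
    ((M%:R)^-1%:E * \sum_(N <- iota 1 M) (\1_[set w | H M N w] w)%:E)%E.
  rewrite sumEFin -EFinM /freq mulrC; congr (_ * _)%:E.
  elim: (iota 1 M) => [|N s IH]; first by rewrite big_nil.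
  by rewrite big_cons /= natrD IH indicE; congr (_%:R + _); rewrite mem_setE.
have m1 M N : measurable_fun setT ((fun w => (\1_[set w | H M N w] w)%:E) : T -> \bar R).
  by apply/measurable_EFinP; apply: measurable_indic.
have mfreq M : measurable_fun setT ((fun w => (freq M w)%:E) : T -> \bar R).
  by under eq_fun do rewrite freqE; apply: measurable_funeM; apply: emeasurable_sum.
have freq_ge0 M w : 0 <= freq M w by rewrite divr_ge0.
have freq_le1 M w : freq M w <= 1.
  rewrite /freq; have [->|M0] := posnP M; first by rewrite invr0 mulr0.
  rewrite ler_pdivrMr ?ltr0n// mul1r ler_nat.
  by rewrite (leq_trans (count_size _ _))// size_iota.
have int_ge M : (0 < M)%N -> (c%:E <= \int[P]_w (freq M w)%:E)%E.
  move=> M0; under eq_integral do rewrite freqE.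
  rewrite ge0_integralZl_EFin ?invr_ge0//; last 2 first.
    by move=> w _; apply: sume_ge0 => N _; rewrite lee_fin.
    exact: emeasurable_sum.
  rewrite ge0_integral_sum//.
  rewrite -[c](mulKf (x := M%:R)) ?pnatr_eq0 -?lt0n// EFinM.
  apply: lee_wpmul2l; first by rewrite lee_fin invr_ge0.
  have -> : (M%:R * c)%:E = (\sum_(N <- iota 1 M) c%:E)%E.
    by rewrite sumEFin big_const_seq count_predT size_iota iter_addr_0 mulr_natl.
  by apply: lee_sum => N _; rewrite integral_indic// setIT; exact: cH.
have lim0 : {ae P, forall w, setT w -> (fun M => (freq M w)%:E) @ \oo --> 0%E}.
  apply: filterS freq0 => w fw _; apply: cvg_EFin => //.
  by apply: nearW.
have dom : {ae P, forall w, forall M, setT w -> (`|(freq M w)%:E| <= (cst 1 w : R)%:E)%E}.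
  by apply: aeW => w n _; rewrite /= lee_fin ger0_norm.
have [_ _] := dominated_convergence measurableT mfreq (measurable_cst 0%E) lim0
   (finite_measure_integrable_cst P 1 measurableT) dom.
rewrite integral_cst// mul0e => /(cvge_ge _).
rewrite -lee_fin; apply.
by exists 1%N => // M /= M0; exact: int_ge.
Qed.

(** Speed at least 1 means that the maximum is at M or beyond by the time
    M + M / q, for every q and all large M. This bounds the delay of M by
    M / q, and [count_all_lag] turns it into a bound r / (2 q) on the
    frequency. *)
Lemma all_lag_frequency_cvg0 (R : realType) (x : int -> nat -> int) (r : nat) (v : R) :
  pm1_steps x -> 1 <= v ->
  (fun n : nat => (frog_max R x n)%:~R / n%:R : R) @ \oo --> v ->
  (fun M : nat => (count (all_lag r (2 * M) x) (iota 1 M))%:R / M%:R : R) @ \oo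
    --> (0 : R).
Proof.
move=> hx v1 cv; apply/cvgr0Pnorm_le => e e0.
have [q qpos qe] : exists2 q : nat, (0 < q)%N & r%:R <= e * q%:R.
  exists (Num.truncn (r%:R / e)).+1 => //.
  by rewrite mulrC -ler_pdivrMr// ltW// truncnS_gt.
(* With this slope, M + M / q time steps suffice to reach M once M >= 2 q. *)
have [n0 _ fast] : \forall n \near \oo, 1 - (2 * q.+1)%:R^-1 <
    (frog_max R x n)%:~R / n%:R :> R.
  by apply: cvgr_gt cv _ _; apply: lt_le_trans v1; rewrite gtrBl invr_gt0 ltr0n.
exists (n0 + 2 * q)%N => // M M0; have {}M0 : (n0 + 2 * q <= M)%N := M0.
have [k kM Mk] : exists2 k, (q * k <= M)%N & (M < q * k + q)%N.
  exists (M %/ q)%N; rewrite mulnC; first exact: leq_divM.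
  by have := ltn_pmod M qpos; have := divn_eq M q; lia.
pose n := (M + k)%N.
have Mn : M%:Z <= frog_max R x n.
  have /fast : (n0 <= n)%N by lia.
  have npos : (0 : R) < n%:R by rewrite ltr0n; lia.
  rewrite ltr_pdivlMr// => lt_max.
  have {}lt_max : (2 * q + 1)%:Z * n%:Z < (2 * q + 2)%:Z * frog_max R x n.
    rewrite -(ltr_int R) !intrM -!pmulrn.
    have E : (2 * q.+1)%:R != 0 :> R by rewrite pnatr_eq0.
    have D : (2 * q.+1)%:R = (2 * q + 1)%:R + 1 :> R by rewrite natr1; congr _%:R; lia.
    have D2 : (2 * q + 2)%:R = (2 * q.+1)%:R :> R by congr _%:R; lia.
    have pos : (0 : R) < (2 * q.+1)%:R by rewrite ltr0n.
    have -> : (2 * q + 1)%:R = (2 * q.+1)%:R - 1 :> R by rewrite D addrK.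
    rewrite -(ltr_pM2l pos) mulrA mulrBr mulr1 divff// in lt_max.
    by rewrite D2.
  rewrite leNgt; apply/negP => lt_M.
  nia.
have [c hc cn] := reached_below_frog_max hx Mn.
have nM : (k <= M)%N by apply: leq_trans kM; rewrite leq_pmull.
have cL : (c <= 2 * M)%N by lia.
have := count_all_lag r hx hc cL; set h := count _ _ => le_h.
have qh : (h * q <= r * M)%N.
  have le_r : (r * (c - M) <= r * k)%N by rewrite leq_mul2l; lia.
  nia.
rewrite ger0_norm ?divr_ge0// ler_pdivrMr ?ltr0n; last by lia.
have q0 : (0 : R) < q%:R by rewrite ltr0n.
rewrite -(ler_pM2r q0) mulrAC.
apply: le_trans (ler_wpM2r (ler0n R M) qe).
by rewrite -!natrM ler_nat.
Qed.

Theorem theorem1p3 (R : realType) (p : R) (hp : 2^-1 <= p) (hp1 : p < 1)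
    (d : measure_display) (T : measurableType d) (P : probability T R)
    (X : int -> nat -> {RV P >-> int}) (hX : frog_steps p X)
    (vmax : R) (hv : speed_of_maximum X vmax) :
  vmax < 1.
Proof.
have p0 : 0 <= p by lra.
have [r [c c0 lag_ge]] := prob_all_lag_ge hX p0 hp1.
rewrite ltNge; apply/negP => v1; move: c0; rewrite ltNge => /negP; apply.
apply: (@prob_le0_of_frequency _ _ _ P
    (fun M N w => all_lag r (2 * M) (fun i k => X i k w) N)) => [M N|M N|].
- exact: measurable_all_lag.
- exact: lag_ge.
- move: (ae_pm1_steps hX) hv; apply: filterS2 => w hx.
  exact: all_lag_frequency_cvg0.
Qed.
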